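(* Let $R$ be a ring, let $\Gamma$ be a complete set of representatives (up to isomorphism) of the finitely presented left $R$-modules, and put $\mathfrak{PI}:=\prod_{S_i\in\Gamma}S_i^{+}$. Then $\mathfrak{PI}$ is a pi-indigent right $R$-module.
   Context: Rings are associative with identity. For a left (right) $R$-module $M$, $M^{+}=\mathrm{Hom}_{\mathbb Z}(M,\mathbb Q/\mathbb Z)$ is its character module, a right (left) $R$-module. A module $M$ is called $N$-subinjective (for $N$ a module on the same side) if for every module $K$ containing $N$ as a submodule, every homomorphism $N\to M$ extends to a homomorphism $K\to M$. The subinjectivity domain of $M$ is $\underline{\mathfrak{In}}^{-1}(M)=\{N : M \text{ is } N\text{-subinjective}\}$. A module $N$ is absolutely pure (fp-injective) if every short exact sequence $0\to N\to B\to C\to 0$ is pure exact (stays exact after tensoring with every module on the other side). A module is pure-injective if it is injective relative to all pure exact sequences. A pure-injective module $M$ is called pi-indigent if $\underline{\mathfrak{In}}^{-1}(M)$ is exactly the class of absolutely pure modules (on the same side as $M$). *)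

(* Defs.v *)
From HB Require Import structures.
From mathcomp Require Import all_boot all_order all_algebra.
From mathcomp Require Import ring_quotient generic_quotient boolp freeg.

Set Implicit Arguments.
Unset Strict Implicit.
Unset Printing Implicit Defensive.

Import GRing.Theory.
Local Open Scope ring_scope.
Local Open Scope quotient_scope.

(* A ring is a [pzRingType], so that the zero ring is allowed.  A left module
   over R is an [lmodType R]; a right module over R is a left module over the
   converse ring, [lmodType R^c], where the right action  m r  is written
   [(r : R^c) *: m]. *)

Definition rat_int (x : rat) : bool := x \is a Num.int.

Fact rat_int_zmod_closed : zmod_closed rat_int.
Proof.
by split=> [|x y]; rewrite ?unfold_in; [exact: rpred0 | exact: rpredB].
Qed.

HB.instance Definition _ :=
  GRing.isZmodClosed.Build rat rat_int rat_int_zmod_closed.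

Definition QmodZ : zmodType :=
  Quotient.quot (GRing.ZmodClosed.clone rat rat_int _).

Section CharacterModule.
Variables (R : pzRingType) (M : lmodType R).

Definition char_module : Type := {additive M -> QmodZ}.

HB.instance Definition _ := gen_eqMixin char_module.
HB.instance Definition _ := gen_choiceMixin char_module.

Implicit Types (f g h : char_module) (r s : R^c).

Lemma char_moduleP f g : (forall m, f m = g m) -> f = g.
Proof.
move=> eq_fg; case: f g eq_fg => [f Hf] [g Hg] /= eq_fg.
have {eq_fg} efg : f = g by apply: functional_extensionality_dep.
case: g / efg Hg => Hg; congr (GRing.Additive.Pack _).
case: Hf Hg => [[Hf]] [[Hg]].
by rewrite (Prop_irrelevance Hf Hg).
Qed.

Definition char_zero : char_module := (\0 : {additive M -> QmodZ}).
Definition char_opp f : char_module := (\- f : {additive M -> QmodZ}).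
Definition char_add f g : char_module := (f \+ g : {additive M -> QmodZ}).
(* the right action  (f r)(m) = f (r m) *)
Definition char_scale (r : R^c) f : char_module :=
  (f \o *:%R (r : R) : {additive M -> QmodZ}).

Fact char_addA : associative char_add.
Proof. by move=> f g h; apply: char_moduleP => m; exact: addrA. Qed.
Fact char_addC : commutative char_add.
Proof. by move=> f g; apply: char_moduleP => m; exact: addrC. Qed.
Fact char_add0 : left_id char_zero char_add.
Proof. by move=> f; apply: char_moduleP => m; exact: add0r. Qed.
Fact char_addN : left_inverse char_zero char_opp char_add.
Proof. by move=> f; apply: char_moduleP => m; exact: addNr. Qed.

HB.instance Definition _ := GRing.isZmodule.Build char_module
  char_addA char_addC char_add0 char_addN.

Fact char_scaleA r s f : char_scale r (char_scale s f) = char_scale (r * s) f.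
Proof.
apply: char_moduleP => m /=.
by rewrite (scalerA (s : R) (r : R)).
Qed.
Fact char_scale1 : left_id 1 char_scale.
Proof. by move=> f; apply: char_moduleP => m /=; rewrite (@scale1r R). Qed.
Fact char_scaleDr : right_distributive char_scale +%R.
Proof. by move=> r f g; apply: char_moduleP. Qed.
Fact char_scaleDl f : {morph char_scale^~ f : r s / r + s}.
Proof.
by move=> r s; apply: char_moduleP => m; rewrite /= (@scalerDl R) raddfD.
Qed.

HB.instance Definition _ := GRing.Zmodule_isLmodule.Build R^c char_module
  char_scaleA char_scale1 char_scaleDr char_scaleDl.

End CharacterModule.

Section ProductModule.
Variables (R : pzRingType) (I : Type) (M : I -> lmodType R).

Definition prod_module : Type := forall i, M i.

HB.instance Definition _ := gen_eqMixin prod_module.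
HB.instance Definition _ := gen_choiceMixin prod_module.

Implicit Types (x y z : prod_module).

Lemma prod_moduleP x y : (forall i, x i = y i) -> x = y.
Proof. exact: functional_extensionality_dep. Qed.

Definition prod_zero : prod_module := fun i => 0.
Definition prod_opp x : prod_module := fun i => - x i.
Definition prod_add x y : prod_module := fun i => x i + y i.
Definition prod_scale (r : R) x : prod_module := fun i => r *: x i.

Fact prod_addA : associative prod_add.
Proof. by move=> x y z; apply: prod_moduleP => i; exact: addrA. Qed.
Fact prod_addC : commutative prod_add.
Proof. by move=> x y; apply: prod_moduleP => i; exact: addrC. Qed.
Fact prod_add0 : left_id prod_zero prod_add.
Proof. by move=> x; apply: prod_moduleP => i; exact: add0r. Qed.
Fact prod_addN : left_inverse prod_zero prod_opp prod_add.
Proof. by move=> x; apply: prod_moduleP => i; exact: addNr. Qed.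

HB.instance Definition _ := GRing.isZmodule.Build prod_module
  prod_addA prod_addC prod_add0 prod_addN.

Fact prod_scaleA r s x : prod_scale r (prod_scale s x) = prod_scale (r * s) x.
Proof. by apply: prod_moduleP => i; exact: scalerA. Qed.
Fact prod_scale1 : left_id 1 prod_scale.
Proof. by move=> x; apply: prod_moduleP => i; exact: scale1r. Qed.
Fact prod_scaleDr : right_distributive prod_scale +%R.
Proof. by move=> r x y; apply: prod_moduleP => i; exact: scalerDr. Qed.
Fact prod_scaleDl x : {morph prod_scale^~ x : r s / r + s}.
Proof. by move=> r s; apply: prod_moduleP => i; exact: scalerDl. Qed.

HB.instance Definition _ := GRing.Zmodule_isLmodule.Build R prod_module
  prod_scaleA prod_scale1 prod_scaleDr prod_scaleDl.

End ProductModule.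

Section Tensor.
Variables (R : pzRingType) (M : lmodType R^c) (L : lmodType R).

(* The subgroup of the free abelian group on M * L generated by the relations
   of biadditivity and  (m r) ⊗ l = m ⊗ (r l). *)
Inductive tensor_rel : {freeg (M * L)} -> Prop :=
| TensorRel0 : tensor_rel 0
| TensorRelB u v : tensor_rel u -> tensor_rel v -> tensor_rel (u - v)
| TensorRelDl (m m' : M) (l : L) :
    tensor_rel (<< (m + m', l) >> - (<< (m, l) >> + << (m', l) >>))
| TensorRelDr (m : M) (l l' : L) :
    tensor_rel (<< (m, l + l') >> - (<< (m, l) >> + << (m, l') >>))
| TensorRelZ (m : M) (r : R) (l : L) :
    tensor_rel (<< ((r : R^c) *: m, l) >> - << (m, r *: l) >>).

Definition tensor_relb (u : {freeg (M * L)}) : bool := `[< tensor_rel u >].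

Fact tensor_relb_zmod_closed : zmod_closed tensor_relb.
Proof.
split=> [|u v]; first exact/asboolP/TensorRel0.
by move=> /asboolP ru /asboolP rv; apply/asboolP/TensorRelB.
Qed.

HB.instance Definition _ :=
  GRing.isZmodClosed.Build {freeg (M * L)} tensor_relb tensor_relb_zmod_closed.

Definition tensor_rels : zmodClosed {freeg (M * L)} :=
  GRing.ZmodClosed.clone {freeg (M * L)} tensor_relb _.

Definition tensor : zmodType := Quotient.quot tensor_rels.

Definition tensor_pi : {freeg (M * L)} -> tensor :=
  \pi_(Quotient.quot tensor_rels).

HB.instance Definition _ := GRing.Additive.copy tensor_pi
  (\pi_(Quotient.quot tensor_rels) : {freeg (M * L)} -> Quotient.quot tensor_rels).

Definition pure_tensor (m : M) (l : L) : tensor := tensor_pi << (m, l) >>.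

Lemma tensor_pi_surj t : exists u, t = tensor_pi u.
Proof.
exists (repr (t : Quotient.quot tensor_rels)).
by rewrite /tensor_pi reprK.
Qed.

Lemma tensor_pi_eq u v : tensor_pi u = tensor_pi v <-> tensor_rel (u - v).
Proof.
split.
  by move/eqP; rewrite /tensor_pi -Quotient.idealrBE => /asboolP.
by move=> ruv; apply/eqP; rewrite /tensor_pi -Quotient.idealrBE; apply/asboolP.
Qed.

End Tensor.

Section TensorMap.
Variables (R : pzRingType) (M M' : lmodType R^c) (f : {linear M -> M'}).
Variable L : lmodType R.

Definition free_map : {freeg (M * L)} -> {freeg (M' * L)} :=
  fglift (fun p => << (f p.1, p.2) >>).

(* f ⊗ L, computed on a representative; the choice of the latter is irrelevant
   by [tensor_map_pi]. *)
Definition tensor_map (t : tensor M L) : tensor M' L :=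
  tensor_pi (free_map (repr (t : Quotient.quot (tensor_rels M L)))).

Fact free_map_zmod_morphism : zmod_morphism free_map.
Proof. exact: lift_is_additive. Qed.

HB.instance Definition _ :=
  GRing.isZmodMorphism.Build _ _ free_map free_map_zmod_morphism.

Lemma free_mapU m l : free_map << (m, l) >> = << (f m, l) >>.
Proof. by rewrite /free_map liftU scale1r. Qed.

Lemma free_map_rel u : tensor_rel u -> tensor_rel (free_map u).
Proof.
elim=> [|{}u v _ ru _ rv|m m' l|m l l'|m r l].
- by rewrite raddf0; exact: TensorRel0.
- by rewrite raddfB; exact: TensorRelB.
- by rewrite raddfB raddfD /= !free_mapU raddfD; exact: TensorRelDl.
- by rewrite raddfB raddfD /= !free_mapU; exact: TensorRelDr.
- by rewrite raddfB /= !free_mapU linearZ; exact: TensorRelZ.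
Qed.

Lemma tensor_map_pi u : tensor_map (tensor_pi u) = tensor_pi (free_map u).
Proof.
apply/tensor_pi_eq; rewrite -raddfB; apply: free_map_rel.
by apply/tensor_pi_eq; rewrite /tensor_pi reprK.
Qed.

Fact tensor_map_zmod_morphism : zmod_morphism tensor_map.
Proof.
move=> x y; have [[u ->] [v ->]] := (tensor_pi_surj x, tensor_pi_surj y).
by rewrite -raddfB !tensor_map_pi !raddfB.
Qed.

HB.instance Definition _ :=
  GRing.isZmodMorphism.Build _ _ tensor_map tensor_map_zmod_morphism.

Lemma tensor_map_pure m l :
  tensor_map (pure_tensor m l) = pure_tensor (f m) l.
Proof. by rewrite tensor_map_pi free_mapU. Qed.

End TensorMap.

Arguments tensor_map [R M M'] f L t.

Definition short_exact (A B C : zmodType) (f : A -> B) (g : B -> C) : Prop :=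
  [/\ injective f,
      forall b, g b = 0 <-> exists a, f a = b
    & forall c, exists b, g b = c].

Section RightModules.
Variable R : pzRingType.

Definition pure_exact (A B C : lmodType R^c)
    (f : {linear A -> B}) (g : {linear B -> C}) : Prop :=
  short_exact f g /\
  forall L : lmodType R, short_exact (tensor_map f L) (tensor_map g L).

Definition absolutely_pure (N : lmodType R^c) : Prop :=
  forall (B C : lmodType R^c) (f : {linear N -> B}) (g : {linear B -> C}),
    short_exact f g -> pure_exact f g.

Definition pure_injective (M : lmodType R^c) : Prop :=
  forall (A B C : lmodType R^c) (f : {linear A -> B}) (g : {linear B -> C}),
    pure_exact f g ->
    forall h : {linear A -> M}, exists h' : {linear B -> M},
      forall a, h' (f a) = h a.

(* A module K containing N as a submodule is given by an injective linear map
   N -> K. *)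
Definition subinjective (M N : lmodType R^c) : Prop :=
  forall (K : lmodType R^c) (i : {linear N -> K}), injective i ->
    forall h : {linear N -> M}, exists h' : {linear K -> M},
      forall n, h' (i n) = h n.

Definition subinj_domain (M : lmodType R^c) : lmodType R^c -> Prop :=
  fun N => subinjective M N.

Definition pi_indigent (M : lmodType R^c) : Prop :=
  pure_injective M /\
  forall N : lmodType R^c, subinj_domain M N <-> absolutely_pure N.

End RightModules.

Section LeftModules.
Variable R : pzRingType.

Definition isomorphic (M N : lmodType R) : Prop :=
  exists f : {linear M -> N}, bijective f.

(* exactness of  R^m -> R^n -> M -> 0  for some m and n *)
Definition finitely_presented (M : lmodType R) : Prop :=
  exists (m n : nat) (f : {linear 'rV[R]_m -> 'rV[R]_n})
         (g : {linear 'rV[R]_n -> M}),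
    (forall v, g v = 0 <-> exists u, f u = v) /\ (forall x, exists v, g v = x).

Definition complete_fp_representatives (I : Type) (S : I -> lmodType R) : Prop :=
  [/\ forall i, finitely_presented (S i),
      forall M : lmodType R, finitely_presented M -> exists i, isomorphic M (S i)
    & forall i j, isomorphic (S i) (S j) -> i = j].

End LeftModules.

(* Main.v *)
Require Import Defs.
From mathcomp Require Import all_boot all_algebra.
From HB Require Import structures.
From mathcomp Require Import ring_quotient generic_quotient freeg.
From mathcomp Require Import boolp classical_sets zify.

Set Implicit Arguments.
Unset Strict Implicit.
Unset Printing Implicit Defensive.

Import GRing.Theory Num.Theory.
Local Open Scope ring_scope.
Local Open Scope quotient_scope.

(** The proof rests on the adjunction between tensor products and character
    modules: linear maps from M to the character module of L are the same as
    additive maps from M ⊗ L to Q/Z.  As Q/Z is a divisible group, it is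
    injective and cogenerates the abelian groups, so for a linear map f from A
    to B the following are equivalent ([char_module_injective_along]): every
    map from A to the character module of L extends along f; the map f ⊗ L is
    injective.  Write E for the product of the character modules of the
    finitely presented modules.

    If f starts a pure exact sequence, every f ⊗ L is injective, so maps to
    each factor of E, and hence maps to E, extend along f.  This says that E is
    pure-injective.  If N is absolutely pure, any embedding of N in K starts a
    short exact sequence ending in the cokernel; it is pure, so pure-injectivity
    of E gives the extensions that N-subinjectivity asks for.

    Conversely, let E be N-subinjective, and let f be an embedding of N in B.
    The character module of a finitely presented P is a direct summand of E
    ([char_module_summand_prod]), so it inherits the extension property, and
    f ⊗ P is injective.  The passage from finitely presented P to arbitrary L
    ([tensor_map_injective_fp]) uses that the vanishing of a given element of
    B ⊗ L is witnessed by finitely many linear relations between finitely many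
    elements of L; these define a finitely presented module over L in which the
    element already vanishes.  The rest of the exactness of the tensored
    sequence is the right exactness of the tensor product. *)

(** * Extending additive maps into divisible groups *)

Lemma subrACA (V : zmodType) (x y z t : V) :
  (x - y) - (z - t) = (x - z) - (y - t).
Proof. by rewrite opprD addrACA -opprD. Qed.

Definition divisible (D : zmodType) : Prop :=
  forall (n : nat) (d : D), (0 < n)%N -> exists e : D, e *+ n = d.

(** Applied below to the integers k such that k y lies in a given subgroup;
    n = 0 is the case where k y lies in it for k = 0 only. *)
Lemma int_subgroup_principal (P : int -> Prop) :
  P 0 -> (forall k l, P k -> P l -> P (k - l)) ->
  exists2 n : nat, P n & forall k, P k -> exists m : int, k = m * n.
Proof.
move=> P0 PB.
have PN k : P k -> P (- k) by move=> Pk; rewrite -sub0r; exact: PB.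
have PM k (m : int) : P k -> P (m * k).
  move=> Pk; have Pn n : P (n%:Z * k).
    elim: n => [|n IHn]; first by rewrite mul0r.
    by have := PB _ _ Pk (PN _ IHn); rewrite opprK intS mulrDl mul1r.
  case: (intP m) => [|n|n]; [exact: (Pn 0%N)|exact: Pn|].
  by rewrite mulNr; apply: PN; exact: Pn.
have [exP|noP] := pselect (exists n, `[< (0 < n)%N /\ P n%:Z >]); last first.
  exists 0%N => // k Pk; exists 0; rewrite mul0r.
  apply/eqP; apply: contra_notT noP => k0; exists `|k|%N; apply/asboolP.
  split; first by rewrite absz_gt0.
  have [->//|->] : `|k|%:Z = k \/ `|k|%:Z = - k by lia.
  exact: PN.
case: (ex_minnP exP) => n /asboolP[n_gt0 Pn] minn.
exists n => // k Pk; exists (k %/ n)%Z.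
have n0 : n%:Z != 0 by lia.
have r_ge0 := modz_ge0 k n0; have r_lt := ltz_mod k n0.
rewrite {1}(divz_eq k n); suff -> : (k %% n)%Z = 0 by rewrite addr0.
apply/eqP; case: eqP => // /eqP rN0.
suff /minn : `[< (0 < `|(k %% n)%Z|)%N /\ P `|(k %% n)%Z|%N >].
  by move: r_ge0 r_lt; lia.
apply/asboolP; split; first by rewrite absz_gt0.
rewrite gez0_abs//; have := PB _ _ Pk (PM _ (k %/ n)%Z Pn).
by rewrite {1}(divz_eq k n) addrAC subrr add0r.
Qed.

Section PartialCharacters.
Variables (Y D : zmodType).
Implicit Types (Gamma : set (Y * D)) (y : Y) (d e : D).

(** A homomorphism to D defined on a subgroup of Y only, given by its graph:
    graphs are ordered by inclusion and closed under unions of chains, as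
    required for Zorn's lemma. *)
Definition partial_char Gamma : Prop :=
  [/\ Gamma (0, 0),
      forall y y' d d', Gamma (y, d) -> Gamma (y', d') -> Gamma (y - y', d - d')
    & forall d, Gamma (0, d) -> d = 0].

Lemma partial_char_uniq Gamma y d d' :
  partial_char Gamma -> Gamma (y, d) -> Gamma (y, d') -> d = d'.
Proof.
move=> [_ GB Gfun] Gd Gd'; apply/eqP; rewrite -subr_eq0; apply/eqP/Gfun.
by have := GB _ _ _ _ Gd Gd'; rewrite subrr.
Qed.

Lemma partial_char_mulz Gamma y d (k : int) :
  partial_char Gamma -> Gamma (y, d) -> Gamma (y *~ k, d *~ k).
Proof.
move=> [G0 GB _] Gyd.
have GN z e : Gamma (z, e) -> Gamma (- z, - e).
  by move=> Gze; have := GB _ _ _ _ G0 Gze; rewrite !sub0r.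
have Gn n : Gamma (y *+ n, d *+ n).
  elim: n => [|n IHn]; first by rewrite !mulr0n.
  have := GB _ _ _ _ Gyd (GN _ _ IHn).
  by rewrite !opprK -!mulrS.
by case: (intP k) => [|n|n]; rewrite ?mulrNz -?pmulrn; auto.
Qed.

(** The multiples of y in the domain of Gamma are those of a single n y.  A
    value d at y is compatible with Gamma as soon as n d is the value at n y;
    divisibility provides such a d when n > 0, and d = 0 works when n = 0. *)
Lemma partial_char_value Gamma y : divisible D -> partial_char Gamma ->
  exists d, forall (k : int) e, Gamma (y *~ k, e) -> e = d *~ k.
Proof.
move=> divD pcG; have [G0 GB Gfun] := pcG.
have [||n [e Ge] nP] :=
    int_subgroup_principal (P := fun k => exists e, Gamma (y *~ k, e)).
- by exists 0; rewrite mulr0z.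
- move=> k k' [e Ge] [e' Ge']; exists (e - e').
  by rewrite mulrzBr; exact: GB.
have [d dE] : exists d, d *+ n = e.
  case: n Ge {nP} => [|n] Ge; last exact: divD.
  by exists 0; rewrite mulr0n; apply/esym/Gfun; rewrite mulr0z in Ge.
exists d => k e' Gk.
have [m kE] := nP k (ex_intro _ e' Gk).
apply: (partial_char_uniq pcG Gk).
have := partial_char_mulz m pcG Ge.
by rewrite -dE pmulrn -!mulrzA [n%:Z * m]mulrC -kE.
Qed.

Lemma partial_char_step Gamma y : divisible D -> partial_char Gamma ->
  exists Gamma', [/\ partial_char Gamma', (Gamma `<=` Gamma')%classic &
    exists d, Gamma' (y, d)].
Proof.
move=> divD pcG; have [d dP] := partial_char_value y divD pcG.
have [G0 GB Gfun] := pcG.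
exists [set p | exists k : int, Gamma (p.1 - y *~ k, p.2 - d *~ k)]%classic.
split=> [|[z e] Gze|].
- split=> [|z z' e e' /= [k Gk] [k' Gk']|e /= [k]].
  + by exists 0; rewrite !mulr0z !subr0.
  + exists (k - k'); have := GB _ _ _ _ Gk Gk'.
    by rewrite subrACA -mulrzBr (subrACA e) -mulrzBr.
  + rewrite sub0r -mulrNz => /dP; rewrite mulrNz => /(canRL (subrK _)).
    by rewrite addNr.
- by exists 0; rewrite /= !mulr0z !subr0.
- by exists d, 1; rewrite /= !mulr1z !subrr.
Qed.

(** A graph that is maximal above Gamma has domain Y by the one-step extension,
    so it is the graph of an additive map. *)
Lemma partial_char_extend Gamma : divisible D -> partial_char Gamma ->
  exists chi : {additive Y -> D}, forall y d, Gamma (y, d) -> chi y = d.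
Proof.
move=> divD pcG.
(* The union with Gamma makes the empty chain harmless. *)
pose P (X : set (Y * D)) := partial_char (Gamma `|` X)%classic.
have [|A [PA maxA]] := @Zorn_bigcup _ P.
  move=> F FP totF.
  have both p q : (Gamma `|` \bigcup_(X in F) X)%classic p ->
      (Gamma `|` \bigcup_(X in F) X)%classic q ->
      exists X, [/\ P X, (Gamma `|` X)%classic p, (Gamma `|` X)%classic q &
        (Gamma `|` X `<=` Gamma `|` \bigcup_(X in F) X)%classic].
    have P0 : P set0 by rewrite /P setU0.
    have sub X : F X -> (Gamma `|` X `<=` Gamma `|` \bigcup_(X in F) X)%classic.
      by move=> FX; apply: setUS; exact: bigcup_sup.
    move=> [Gp|[X FX Xp]] [Gq|[X' FX' X'q]].
    - by exists set0; split=> //; [left|left|rewrite setU0; exact: subsetUl].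
    - by exists X'; split=> //; [exact: FP|left|right|exact: sub].
    - by exists X; split=> //; [exact: FP|right|left|exact: sub].
    - have [XX'|X'X] := totF _ _ FX FX'.
        exists X'; split=> //.
        + exact: FP.
        + by right; exact: XX'.
        + by right.
        + exact: sub.
      by exists X; split=> //; [exact: FP|right|right; exact: X'X|exact: sub].
  have [G0 GB Gfun] := pcG.
  split=> [|y y' d d' Hp Hq|d Hd].
  - by left.
  - have [X [[_ XB _] Xp Xq sX]] := both _ _ Hp Hq.
    by apply: sX; exact: XB.
  - by have [X [[_ _ Xfun] Xp _ _]] := both _ _ Hd Hd; exact: Xfun.
pose G := (Gamma `|` A)%classic; rewrite -/G in PA.
have total y : exists d, G (y, d).
  have [G' [pcG' GG' [d G'd]]] := partial_char_step y divD PA.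
  exists d; apply: contrapT => nGd; apply: (maxA G').
    rewrite properEneq; split; last exact: subset_trans GG'.
    by apply/eqP=> AG'; apply: nGd; right; rewrite AG'.
  by rewrite /P setUidr//; apply: subset_trans GG'.
have [chi chiP] := choice total.
have [_ GB _] := PA.
have chiB : zmod_morphism chi.
  move=> y y'; apply: (partial_char_uniq PA (chiP _)).
  exact: (GB _ _ _ _ (chiP _) (chiP _)).
pose chiA := GRing.isZmodMorphism.Build _ _ chi chiB.
exists (HB.pack chi chiA : {additive Y -> D}) => y d Gyd /=.
by apply: (partial_char_uniq PA (chiP _)); left.
Qed.

End PartialCharacters.

(** * Characters of abelian groups *)

Lemma QmodZ_divisible : divisible QmodZ.
Proof.
move=> n d n_gt0; pose x := repr d.
exists (\pi_QmodZ (x / n%:R)).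
rewrite -[d]reprK -/x -[LHS]raddfMn -[_ *+ n]mulr_natr divfK//.
by rewrite pnatr_eq0 -lt0n.
Qed.

Fact QmodZ_torsion (n : nat) : exists2 d : QmodZ, d != 0 & d *+ n.+2 = 0.
Proof.
have n0 : n.+2%:R != 0 :> rat by rewrite pnatr_eq0.
exists (\pi_QmodZ n.+2%:R^-1).
  rewrite -(raddf0 \pi_QmodZ) -Quotient.idealrBE subr0.
  rewrite /in_mem /= /rat_int; apply/negP => /intrP[k kE].
  have : (k * n.+2)%:~R = 1 :> rat by rewrite intrM -kE mulVf//.
  move/eqP; rewrite -[1]/(1%:~R) eqr_int => /eqP.
  have [] : k <= 0 \/ 1 <= k by lia.
    nia.
  nia.
rewrite -raddfMn -(raddf0 \pi_QmodZ).
apply/eqP; rewrite -Quotient.idealrBE subr0 -[_ *+ _]mulr_natr mulVf//.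
Qed.

(** The value n = 0 stands for infinite order: an element of order n in an
    abelian group may be sent to d.  Only n = 1 forces d = 0. *)
Lemma QmodZ_annihilated (n : nat) : n != 1%N ->
  exists2 d : QmodZ, d != 0 & d *+ n = 0.
Proof.
case: n => [|[//|m]] _.
  by have [d d0 _] := QmodZ_torsion 0; exists d.
by have [d d0 dm] := QmodZ_torsion m; exists d.
Qed.

Lemma character_extend (X Y : zmodType) (f : {additive X -> Y})
    (chi : {additive X -> QmodZ}) : injective f ->
  exists chi' : {additive Y -> QmodZ}, forall x, chi' (f x) = chi x.
Proof.
move=> injf.
pose Gamma : set (Y * QmodZ) := [set p | exists x, p = (f x, chi x)]%classic.
have [||chi' chi'P] := @partial_char_extend _ _ Gamma.
- exact: QmodZ_divisible.
- split=> [|y y' d d' [x [-> ->]] [x' [-> ->]]|d [x [fx0 ->]]].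
  + by exists 0; rewrite !raddf0.
  + by exists (x - x'); rewrite !raddfB.
  + by rewrite (injf x 0) ?raddf0.
- by exists chi' => x; apply: chi'P; exists x.
Qed.

(** A nonzero class killed by the order of y defines a nonzero character on the
    subgroup generated by y, and characters extend. *)
Lemma character_separates (Y : zmodType) (y : Y) : y != 0 ->
  exists chi : {additive Y -> QmodZ}, chi y != 0.
Proof.
move=> y0.
have [q q0 qP] : exists2 q : QmodZ, q != 0 &
    forall k : int, y *~ k = 0 -> q *~ k = 0.
  have [||n yn nP] := int_subgroup_principal (P := fun k => y *~ k = 0).
  - exact: mulr0z.
  - by move=> k l yk yl; rewrite mulrzBr yk yl subr0.
  have n1 : n != 1%N by apply: contra_neq y0 => n1; rewrite n1 in yn.
  have [q q0 qn] := QmodZ_annihilated n1; exists q => // k /nP[m ->].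
  by rewrite mulrC mulrzA -pmulrn qn mul0rz.
pose Gamma : set (Y * QmodZ) :=
  [set p | exists k : int, p = (y *~ k, q *~ k)]%classic.
have [||chi chiP] := @partial_char_extend _ _ Gamma.
- exact: QmodZ_divisible.
- split=> [|_ _ _ _ [k [-> ->]] [k' [-> ->]]|d [k [/esym/qP + ->]]] //.
  + by exists 0; rewrite !mulr0z.
  + by exists (k - k'); rewrite !mulrzBr.
- by exists chi; rewrite (chiP y q)//; exists 1; rewrite !mulr1z.
Qed.

(** * Additive maps out of free abelian groups and tensor products *)

Section FreeLift.
Variables (K : choiceType) (A : zmodType) (f : K -> A).

(** The coefficients of the free abelian group are integers, so A is used here
    through its structure of module over them. *)
Definition free_lift (u : {freeg K}) : A := fglift (f : K -> zmodule A) u.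

Fact free_lift_is_zmod_morphism : zmod_morphism free_lift.
Proof. by move=> u v; exact: (lift_is_additive (M := zmodule A) f). Qed.

HB.instance Definition _ := GRing.isZmodMorphism.Build _ _ free_lift
  free_lift_is_zmod_morphism.

Lemma free_liftU k : free_lift << k >> = f k.
Proof. by rewrite /free_lift liftU scalezrE mulr1z. Qed.

End FreeLift.

Lemma freeg_ext_dom (K : choiceType) (A : zmodType)
    (g h : {additive {freeg K} -> A}) (u : {freeg K}) :
  {in dom u, forall k, g << k >> = h << k >>} -> g u = h u.
Proof.
move=> gh; rewrite -(freeg_sumE u) !raddf_sum; apply: eq_big_seq => k /gh ghk.
by rewrite -[coeff k u]intz -freegU_mulz !raddfMz ghk.
Qed.

Lemma freeg_ext (K : choiceType) (A : zmodType)
    (g h : {additive {freeg K} -> A}) :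
  (forall k, g << k >> = h << k >>) -> g =1 h.
Proof. by move=> gh u; apply: freeg_ext_dom => k _; exact: gh. Qed.

Section TensorLift.
Variables (R : pzRingType) (M : lmodType R^c) (L : lmodType R).

Lemma pure_tensorDl (m m' : M) (l : L) :
  pure_tensor (m + m') l = pure_tensor m l + pure_tensor m' l.
Proof. by rewrite -raddfD; apply/tensor_pi_eq; exact: TensorRelDl. Qed.

Lemma pure_tensorDr (m : M) (l l' : L) :
  pure_tensor m (l + l') = pure_tensor m l + pure_tensor m l'.
Proof. by rewrite -raddfD; apply/tensor_pi_eq; exact: TensorRelDr. Qed.

Lemma pure_tensorZ (m : M) (r : R) (l : L) :
  pure_tensor ((r : R^c) *: m) l = pure_tensor m (r *: l).
Proof. by apply/tensor_pi_eq; exact: TensorRelZ. Qed.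

Fact pure_tensorBl (l : L) : zmod_morphism (fun m : M => pure_tensor m l).
Proof.
move=> m m'; apply/eqP; rewrite eq_sym subr_eq; apply/eqP.
by rewrite -pure_tensorDl subrK.
Qed.

Fact pure_tensorBr (m : M) : zmod_morphism (@pure_tensor R M L m).
Proof.
move=> l l'; apply/eqP; rewrite eq_sym subr_eq; apply/eqP.
by rewrite -pure_tensorDr subrK.
Qed.

HB.instance Definition _ (m : M) :=
  GRing.isZmodMorphism.Build L (tensor M L) (@pure_tensor R M L m)
    (@pure_tensorBr m).

Lemma tensor_ext (A : zmodType) (g h : {additive tensor M L -> A}) :
  (forall m l, g (pure_tensor m l) = h (pure_tensor m l)) -> g =1 h.
Proof.
move=> gh t; have [u ->] := tensor_pi_surj t.
apply: (@freeg_ext _ _ (g \o @tensor_pi R M L) (h \o @tensor_pi R M L) _ u).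
by move=> [m l]; exact: gh.
Qed.

(** The universal property of the tensor product: balanced biadditive maps kill
    [tensor_rel]. *)
Lemma tensor_lift (A : zmodType) (b : M -> L -> A) :
    (forall m m' l, b (m + m') l = b m l + b m' l) ->
    (forall m l l', b m (l + l') = b m l + b m l') ->
    (forall m (r : R) l, b ((r : R^c) *: m) l = b m (r *: l)) ->
  exists T : {additive tensor M L -> A},
    forall m l, T (pure_tensor m l) = b m l.
Proof.
move=> bDl bDr bZ; pose F : {additive {freeg (M * L)} -> A} :=
  free_lift (fun p : M * L => b p.1 p.2).
have F0 u : tensor_rel u -> F u = 0.
  elim=> {u} [|u v _ u0 _ v0|m m' l|m l l'|m r l].
  - exact: raddf0.
  - by rewrite raddfB u0 v0 subr0.
  - by rewrite raddfB raddfD /= !free_liftU bDl subrr.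
  - by rewrite raddfB raddfD /= !free_liftU bDr subrr.
  - by rewrite raddfB /= !free_liftU bZ subrr.
pose T (t : tensor M L) := F (repr (t : Quotient.quot (tensor_rels M L))).
have Tpi u : T (tensor_pi u) = F u.
  apply/eqP; rewrite -subr_eq0 -raddfB; apply/eqP/F0/tensor_pi_eq.
  by rewrite /tensor_pi reprK.
have TB : zmod_morphism T.
  move=> s t; have [[u ->] [v ->]] := (tensor_pi_surj s, tensor_pi_surj t).
  by rewrite -raddfB !Tpi raddfB.
pose TA := GRing.isZmodMorphism.Build _ _ T TB.
exists (HB.pack T TA : {additive tensor M L -> A}) => m l /=.
by rewrite Tpi; exact: free_liftU.
Qed.

End TensorLift.

(** * Cokernels *)

Section Cokernel.
Variables (R : pzRingType) (A B : lmodType R) (f : {linear A -> B}).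

Definition in_range (b : B) : bool := `[< exists a, f a = b >].

Fact in_range_zmod_closed : zmod_closed in_range.
Proof.
split=> [|b b' /asboolP[a <-] /asboolP[a' <-]]; apply/asboolP.
  by exists 0; rewrite raddf0.
by exists (a - a'); rewrite raddfB.
Qed.

HB.instance Definition _ :=
  GRing.isZmodClosed.Build B in_range in_range_zmod_closed.

Definition range_subgroup : zmodClosed B := GRing.ZmodClosed.clone B in_range _.

Definition coker : Type := Quotient.quot range_subgroup.

HB.instance Definition _ :=
  GRing.Zmodule.copy coker (Quotient.quot range_subgroup).

Definition coker_pi (b : B) : coker := \pi_(Quotient.quot range_subgroup) b.

Lemma coker_pi_surj (c : coker) : exists b, coker_pi b = c.
Proof. by exists (repr (c : Quotient.quot range_subgroup)); exact: reprK. Qed.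

Lemma coker_pi_eq b b' : coker_pi b = coker_pi b' <-> exists a, f a = b - b'.
Proof.
split=> [/eqP|fab].
  by rewrite /coker_pi -Quotient.idealrBE => /asboolP.
by apply/eqP; rewrite /coker_pi -Quotient.idealrBE; apply/asboolP.
Qed.

Fact coker_pi_is_zmod_morphism : zmod_morphism coker_pi.
Proof. exact: (raddfB \pi_(Quotient.quot range_subgroup)). Qed.

HB.instance Definition _ := GRing.isZmodMorphism.Build B coker coker_pi
  coker_pi_is_zmod_morphism.

Definition coker_scale (r : R) (c : coker) : coker :=
  coker_pi (r *: repr (c : Quotient.quot range_subgroup)).

Fact coker_scale_pi r b : coker_scale r (coker_pi b) = coker_pi (r *: b).
Proof.
apply/coker_pi_eq; rewrite -scalerBr.
suff /coker_pi_eq[a <-] :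
    coker_pi (repr (coker_pi b : Quotient.quot range_subgroup)) = coker_pi b.
  by exists (r *: a); rewrite linearZ.
exact: reprK.
Qed.

Fact coker_scaleA r s c :
  coker_scale r (coker_scale s c) = coker_scale (r * s) c.
Proof.
by have [b <-] := coker_pi_surj c; rewrite !coker_scale_pi scalerA.
Qed.
Fact coker_scale1 : left_id 1 coker_scale.
Proof.
by move=> c; have [b <-] := coker_pi_surj c; rewrite coker_scale_pi scale1r.
Qed.
Fact coker_scaleDr : right_distributive coker_scale +%R.
Proof.
move=> r c c'; have [b <-] := coker_pi_surj c; have [b' <-] := coker_pi_surj c'.
by rewrite -raddfD !coker_scale_pi -raddfD scalerDr.
Qed.
Fact coker_scaleDl c : {morph coker_scale^~ c : r s / r + s}.
Proof.
move=> r s; have [b <-] := coker_pi_surj c.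
by rewrite !coker_scale_pi -raddfD scalerDl.
Qed.

HB.instance Definition _ := GRing.Zmodule_isLmodule.Build R coker
  coker_scaleA coker_scale1 coker_scaleDr coker_scaleDl.

Fact coker_pi_is_scalable : scalable coker_pi.
Proof. by move=> r b; rewrite -coker_scale_pi. Qed.

HB.instance Definition _ := GRing.isScalable.Build R B coker *:%R coker_pi
  coker_pi_is_scalable.

Lemma coker_pi_eq0 b : coker_pi b = 0 <-> exists a, f a = b.
Proof. by rewrite -(raddf0 coker_pi) coker_pi_eq subr0. Qed.

Lemma coker_short_exact : injective f -> short_exact f coker_pi.
Proof.
by move=> injf; split=> //; [exact: coker_pi_eq0 | exact: coker_pi_surj].
Qed.

Lemma coker_lift (L : lmodType R) (g : {linear B -> L}) :
    (forall a, g (f a) = 0) ->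
  exists h : {linear coker -> L}, forall b, h (coker_pi b) = g b.
Proof.
move=> gf; pose h (c : coker) := g (repr (c : Quotient.quot range_subgroup)).
have hpi b : h (coker_pi b) = g b.
  have /coker_pi_eq[a fa] :
      coker_pi (repr (coker_pi b : Quotient.quot range_subgroup)) = coker_pi b.
    exact: reprK.
  by apply/eqP; rewrite -subr_eq0 -linearB -fa gf.
have h_lin : linear h.
  move=> r c c'; have [b <-] := coker_pi_surj c.
  have [b' <-] := coker_pi_surj c'.
  by rewrite -linearP !hpi linearP.
pose hL := GRing.isLinear.Build R coker L *:%R h h_lin.
by exists (HB.pack h hL : {linear coker -> L}).
Qed.

End Cokernel.

(** * Character modules and tensor products *)

Section CharacterDuality.
Variable R : pzRingType.

Lemma char_curry (M : lmodType R^c) (L : lmodType R)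
    (chi : {additive tensor M L -> QmodZ}) :
  exists h : {linear M -> char_module L},
    forall m l, (h m : {additive L -> QmodZ}) l = chi (pure_tensor m l).
Proof.
pose h (m : M) : char_module L :=
  (chi \o @pure_tensor R M L m : {additive L -> QmodZ}).
have h_lin : linear h.
  move=> r m m'; apply: char_moduleP => l /=.
  by rewrite pure_tensorDl raddfD pure_tensorZ.
pose hL := GRing.isLinear.Build R^c M (char_module L) *:%R h h_lin.
by exists (HB.pack h hL : {linear M -> char_module L}).
Qed.

Lemma char_uncurry (M : lmodType R^c) (L : lmodType R)
    (h : {linear M -> char_module L}) :
  exists chi : {additive tensor M L -> QmodZ},
    forall m l, chi (pure_tensor m l) = (h m : {additive L -> QmodZ}) l.
Proof.
apply: tensor_lift => [m m' l|m l l'|m r l].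
- by rewrite raddfD.
- by rewrite raddfD.
- by rewrite linearZ.
Qed.

(** By the adjunction, the extension property on the left says that every
    character of A ⊗ L is the composite of f ⊗ L and a character of B ⊗ L.
    This holds when f ⊗ L is injective, as Q/Z is an injective group; and it
    forces f ⊗ L to be injective, as characters detect nonzero elements. *)
Lemma char_module_injective_along (A B : lmodType R^c) (f : {linear A -> B})
    (L : lmodType R) :
  (forall h : {linear A -> char_module L},
     exists h' : {linear B -> char_module L}, forall a, h' (f a) = h a) <->
  injective (tensor_map f L).
Proof.
split=> [ext|inj h].
  apply: raddf_inj => t ft0.
  apply: contrapT => /eqP /character_separates[chi] /eqP; apply.
  have [h hE] := char_curry chi.
  have [h' h'E] := ext h.
  have [chi' chi'E] := char_uncurry h'.
  transitivity (chi' (tensor_map f L t)); last by rewrite ft0 raddf0.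
  apply: (@tensor_ext _ _ _ _ chi (chi' \o tensor_map f L)) => a l /=.
  by rewrite tensor_map_pure chi'E h'E hE.
have [chi chiE] := char_uncurry h.
have [chi' chi'E] := character_extend chi inj.
have [h' h'E] := char_curry chi'.
exists h' => a; apply: char_moduleP => l.
by rewrite h'E -tensor_map_pure chi'E chiE.
Qed.

End CharacterDuality.

(** * Maps into products *)

Section ProductMaps.
Variables (R : pzRingType) (I : Type) (M : I -> lmodType R).

Fact prod_proj_is_linear (i : I) : linear (fun x : prod_module M => x i).
Proof. by []. Qed.

Definition prod_proj (i : I) : {linear prod_module M -> M i} :=
  HB.pack (fun x : prod_module M => x i)
    (GRing.isLinear.Build R (prod_module M) (M i) *:%R _
      (prod_proj_is_linear i)).

Lemma prod_map (A : lmodType R) (h : forall i, {linear A -> M i}) :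
  exists g : {linear A -> prod_module M}, forall a i, g a i = h i a.
Proof.
pose g (a : A) : prod_module M := fun i => h i a.
have g_lin : linear g.
  by move=> r a a'; apply: prod_moduleP => i; rewrite /g linearP.
pose gL := GRing.isLinear.Build R A (prod_module M) *:%R g g_lin.
by exists (HB.pack g gL : {linear A -> prod_module M}).
Qed.

End ProductMaps.

Lemma prod_char_module_pure_injective (R : pzRingType) (I : Type)
    (S : I -> lmodType R) :
  pure_injective (prod_module (fun i => char_module (S i))).
Proof.
move=> A B C f g [_ pure_fg] h.
have ext i : exists h' : {linear B -> char_module (S i)},
    forall a, h' (f a) = h a i.
  have [inj _ _] := pure_fg (S i).
  exact: ((char_module_injective_along f (S i)).2 inj (prod_proj _ i \o h)).
have [k kE] := prod_map (fun i => projT1 (cid (ext i))).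
exists k => a; apply: prod_moduleP => i.
by rewrite kE; case: (cid (ext i)) => h' /= ->.
Qed.

(** * Right exactness of the tensor product *)

(** The inverse of the map from the cokernel of f ⊗ L to C ⊗ L is given on the
    free group on C * L by sigma, which sends (c, l) to s c ⊗ l for a
    set-theoretic section s of g.  The section is not additive, but its defects
    lie in the kernel of g, that is in the range of f, so sigma sends the
    defining relations of C ⊗ L into the range of f ⊗ L. *)
Lemma tensor_right_exact (R : pzRingType) (A B C : lmodType R^c)
    (f : {linear A -> B}) (g : {linear B -> C}) (L : lmodType R) :
    short_exact f g ->
  (forall t, tensor_map g L t = 0 <-> exists s, tensor_map f L s = t) /\
  (forall t, exists s, tensor_map g L s = t).
Proof.
move=> [_ kerg /choice[s sE]].
have /choice[a aE] b : exists a, f a = s (g b) - b.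
  by apply/kerg; rewrite linearB sE subrr.
pose sigma : {additive {freeg (C * L)} -> tensor B L} :=
  free_lift (fun p => pure_tensor (s p.1) p.2).
pose alpha : {additive {freeg (B * L)} -> tensor A L} :=
  free_lift (fun p => pure_tensor (a p.1) p.2).
have sigmaE u : tensor_map g L (sigma u) = tensor_pi u.
  apply: (@freeg_ext _ _ (tensor_map g L \o sigma) (@tensor_pi R C L) _ u).
  by move=> [c l] /=; rewrite free_liftU /= tensor_map_pure sE.
(* The two lifts of g b, namely s (g b) and b, differ by f (a b). *)
have alphaE u : tensor_map f L (alpha u) = sigma (free_map g u) - tensor_pi u.
  apply: (@freeg_ext _ _ (tensor_map f L \o alpha)
    ((sigma \o @free_map _ _ _ g L) \- @tensor_pi R B L) _ u).
  move=> [b l] /=; rewrite free_liftU free_mapU free_liftU /=.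
  by rewrite tensor_map_pure aE -pure_tensorBl.
have range_pure b l : g b = 0 -> exists t, tensor_map f L t = pure_tensor b l.
  by move=> /kerg[x <-]; exists (pure_tensor x l); rewrite tensor_map_pure.
have sigma_rel w : tensor_rel w -> exists t, tensor_map f L t = sigma w.
  elim=> {w} [|u v _ [t tE] _ [t' t'E]|c c' l|c l l'|c r l].
  - by exists 0; rewrite !raddf0.
  - by exists (t - t'); rewrite !raddfB /= tE t'E.
  - rewrite raddfB raddfD /= !free_liftU /= -pure_tensorDl -pure_tensorBl.
    by apply: range_pure; rewrite linearB linearD !sE subrr.
  - exists 0.
    by rewrite raddfB raddfD /= !free_liftU /= -pure_tensorDr subrr raddf0.
  - rewrite raddfB /= !free_liftU /= -pure_tensorZ -pure_tensorBl.
    by apply: range_pure; rewrite linearB linearZ !sE subrr.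
split=> t; last first.
  by have [u ->] := tensor_pi_surj t; exists (sigma u).
split=> [|[x <-]]; last first.
  apply: (@tensor_ext _ _ _ _ (tensor_map g L \o tensor_map f L) \0 _ x).
  move=> x' l /=.
  rewrite !tensor_map_pure; have -> : g (f x') = 0 by apply/kerg; exists x'.
  by rewrite -(subrr 0) pure_tensorBl subrr.
have [u ->] := tensor_pi_surj t; rewrite tensor_map_pi => gu0.
have /sigma_rel[x xE] : tensor_rel (free_map g u).
  by rewrite -[free_map g u]subr0; apply/tensor_pi_eq; rewrite raddf0.
exists (x - alpha u); rewrite raddfB /= xE alphaE.
by rewrite opprB addrCA subrr addr0.
Qed.

(** * Reduction to finitely presented modules *)

(** Finitely many linear relations rho of L already force u to vanish in the
    tensor product with B, whichever module P and family e satisfying rho are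
    put in the place of L.  Quantifying over all P and e makes the relations for
    a difference just the concatenation of those for its terms. *)
Lemma tensor_rel_finite (R : pzRingType) (B : lmodType R^c) (L : lmodType R)
    (u : {freeg (B * L)}) : tensor_rel u ->
  exists rho : seq (seq (R * L)),
    {in rho, forall w, \sum_(p <- w) p.1 *: p.2 = 0} /\
    forall (P : lmodType R) (e : L -> P),
      {in rho, forall w, \sum_(p <- w) p.1 *: e p.2 = 0} ->
      free_lift (fun p => pure_tensor p.1 (e p.2)) u = 0.
Proof.
elim=> {u} [|u v _ [rho [rho0 urho]] _ [rho' [rho'0 vrho']]
           |b b' l|b l l'|b r l].
- by exists [::]; split=> // P e _; rewrite raddf0.
- exists (rho ++ rho'); split=> [w|P e e0].
    by rewrite mem_cat => /orP[/rho0|/rho'0].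
  rewrite raddfB /= urho ?vrho' ?subr0// => w wrho; apply: e0.
    by rewrite mem_cat wrho orbT.
  by rewrite mem_cat wrho.
- exists [::]; split=> // P e _.
  by rewrite raddfB raddfD /= !free_liftU /= pure_tensorDl subrr.
- exists [:: [:: (1, l + l'); (-1, l); (-1, l')]].
  have E (P : lmodType R) (e : L -> P) :
      \sum_(p <- [:: (1, l + l'); (-1, l); (-1, l')]) p.1 *: e p.2 =
      e (l + l') - (e l + e l').
    by rewrite !big_cons big_nil /= scale1r !scaleN1r addr0 opprD.
  split=> [w|P e e0].
    by rewrite inE => /eqP ->; rewrite (E L id) subrr.
  have /eqP := e0 _ (mem_head _ _); rewrite E subr_eq0 => /eqP ell'.
  by rewrite raddfB raddfD /= !free_liftU /= ell' pure_tensorDr subrr.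
- exists [:: [:: (r, l); (-1, r *: l)]].
  have E (P : lmodType R) (e : L -> P) :
      \sum_(p <- [:: (r, l); (-1, r *: l)]) p.1 *: e p.2 =
      r *: e l - e (r *: l).
    by rewrite !big_cons big_nil /= !scaleN1r addr0.
  split=> [w|P e e0].
    by rewrite inE => /eqP ->; rewrite (E L id) subrr.
  have /eqP := e0 _ (mem_head _ _); rewrite E subr_eq0 => /eqP erl.
  by rewrite raddfB /= !free_liftU /= pure_tensorZ erl subrr.
Qed.

(** P is the free module on the elements of L that occur in X or in rho, modulo
    the relations rho. *)
Lemma finitely_presented_approximation (R : pzRingType) (L : lmodType R)
    (X : seq L) (rho : seq (seq (R * L))) :
    {in rho, forall w, \sum_(p <- w) p.1 *: p.2 = 0} ->
  exists (P : lmodType R) (e : L -> P) (phi : {linear P -> L}),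
    [/\ finitely_presented P,
        {in rho, forall w, \sum_(p <- w) p.1 *: e p.2 = 0}
      & {in X, forall l, phi (e l) = l}].
Proof.
move=> rho0; pose Y := X ++ [seq p.2 | p <- flatten rho].
pose n := size Y; pose m := size rho.
(* The basis vector of l; it is zero if l does not occur in Y. *)
pose delta l : 'rV[R]_n := \row_j (if j == index l Y :> nat then 1 else 0).
pose row_rel (w : seq (R * L)) := \sum_(p <- w) p.1 *: delta p.2.
pose f (v : 'rV[R]_m) := \sum_(i < m) v 0 i *: row_rel (nth [::] rho i).
pose psi (v : 'rV[R]_n) := \sum_(j < n) v 0 j *: nth 0 Y j.
have f_lin : linear f.
  move=> r v v'; rewrite scaler_sumr -big_split; apply: eq_bigr => i _ /=.
  by rewrite !mxE scalerDl scalerA.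
have psi_lin : linear psi.
  move=> r v v'; rewrite scaler_sumr -big_split; apply: eq_bigr => i _ /=.
  by rewrite !mxE scalerDl scalerA.
pose fL : {linear 'rV[R]_m -> 'rV[R]_n} :=
  HB.pack f (GRing.isLinear.Build R _ _ *:%R f f_lin).
pose psiL : {linear 'rV[R]_n -> L} :=
  HB.pack psi (GRing.isLinear.Build R _ _ *:%R psi psi_lin).
have psi_delta l : l \in Y -> psiL (delta l) = l.
  move=> lY; have lt_l : (index l Y < n)%N by rewrite index_mem.
  rewrite /= /psi (bigD1 (Ordinal lt_l))//= big1 => [|j /eqP jl].
    by rewrite mxE eqxx scale1r addr0 nth_index.
  rewrite mxE; case: eqP => [jE|]; last by rewrite scale0r.
  by case: jl; apply: val_inj.
have psi_rel w : w \in rho -> psiL (row_rel w) = 0.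
  move=> wrho; rewrite linear_sum -[RHS](rho0 w wrho).
  apply: eq_big_seq => p pw.
  rewrite linearZ_LR psi_delta// mem_cat; apply/orP; right.
  by apply/map_f/flattenP; exists w.
have [phi phiE] : exists phi : {linear coker fL -> L},
    forall v, phi (coker_pi fL v) = psiL v.
  apply: coker_lift => v; rewrite [fL v]/(f v) linear_sum big1// => i _.
  by rewrite linearZ_LR psi_rel ?scaler0// mem_nth.
exists (coker fL), (fun l => coker_pi fL (delta l)), phi; split.
- exists m, n, fL, (coker_pi fL); split; first exact: coker_pi_eq0.
  exact: coker_pi_surj.
- move=> w wrho.
  under eq_bigr do rewrite -linearZ.
  rewrite -linear_sum; apply/coker_pi_eq0.
  have lt_w : (index w rho < m)%N by rewrite index_mem.
  exists (delta_mx 0 (Ordinal lt_w)).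
  rewrite [LHS]/= /f (bigD1 (Ordinal lt_w))//= big1 => [|j jw].
    by rewrite mxE !eqxx scale1r addr0 nth_index.
  by rewrite mxE eqxx (negbTE jw) scale0r.
- by move=> l lX; rewrite phiE psi_delta// mem_cat lX.
Qed.

(** Let u represent a class that f ⊗ L sends to 0.  The approximation P of L
    satisfies the relations that make its image vanish, so the lift of u to
    A ⊗ P is in the kernel of f ⊗ P, hence zero.  The map from P to L sends this
    lift back to the class of u. *)
Lemma tensor_map_injective_fp (R : pzRingType) (A B : lmodType R^c)
    (f : {linear A -> B}) :
    (forall P : lmodType R,
       finitely_presented P -> injective (tensor_map f P)) ->
  forall L : lmodType R, injective (tensor_map f L).
Proof.
move=> inj_fp L; apply: raddf_inj => t.
have [u ->] := tensor_pi_surj t; rewrite /= tensor_map_pi => fu0.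
have /tensor_rel_finite[rho [rho0 rhoP]] : tensor_rel (free_map f u).
  by rewrite -[free_map f u]subr0; apply/tensor_pi_eq; rewrite raddf0.
have [P [e [phi [fpP e0 phie]]]] :=
  finitely_presented_approximation [seq p.2 | p <- dom u] rho0.
pose lift (M : lmodType R^c) : {additive {freeg (M * L)} -> tensor M P} :=
  free_lift (fun p => pure_tensor p.1 (e p.2)).
have lift0 : lift A u = 0.
  apply: (inj_fp P fpP); rewrite raddf0 -[RHS](rhoP P e e0).
  apply: (@freeg_ext _ _ (tensor_map f P \o lift A)
    (lift B \o @free_map _ _ _ f L) _ u).
  by move=> [a l] /=; rewrite free_mapU !free_liftU tensor_map_pure.
have [T TE] : exists T : {additive tensor A P -> tensor A L},
    forall a p, T (pure_tensor a p) = pure_tensor a (phi p).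
  apply: tensor_lift => [a a' p|a p p'|a r p].
  - exact: pure_tensorDl.
  - by rewrite raddfD pure_tensorDr.
  - by rewrite linearZ pure_tensorZ.
rewrite -[RHS](raddf0 T) -lift0; apply/esym.
apply: (@freeg_ext_dom _ _ (T \o lift A) (@tensor_pi R A L)) => -[a l] alu /=.
by rewrite free_liftU TE phie//; apply/mapP; exists (a, l).
Qed.

(** * Subinjectivity and absolute purity *)

Section CharacterMaps.
Variables (R : pzRingType) (L P : lmodType R) (tau : {linear L -> P}).

Definition char_map_fun (phi : char_module P) : char_module L :=
  ((phi : {additive P -> QmodZ}) \o tau : {additive L -> QmodZ}).

Fact char_map_fun_is_linear : linear char_map_fun.
Proof. by move=> r phi psi; apply: char_moduleP => l; rewrite /= linearZ. Qed.

Definition char_map : {linear char_module P -> char_module L} :=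
  HB.pack char_map_fun
    (GRing.isLinear.Build R^c _ _ *:%R char_map_fun char_map_fun_is_linear).

End CharacterMaps.

(** Precomposition with maps tau j from the S j to P embeds the character module
    of P in the product as soon as one tau j has a section, and then
    precomposition with the section gives the retraction.  The isomorphism with
    S i is put at its place in the family without deciding equality of indices:
    tau j has a section whenever some map from S j to P has one. *)
Lemma char_module_summand_prod (R : pzRingType) (I : Type) (S : I -> lmodType R)
    (P : lmodType R) (i : I) : isomorphic P (S i) ->
  exists
    (iota : {linear char_module P -> prod_module (fun i => char_module (S i))})
    (rho : {linear prod_module (fun i => char_module (S i)) -> char_module P}),
    cancel iota rho.
Proof.
move=> [sigma [tau0 sigmaK tau0K]].
pose retraction j (tau : {linear S j -> P}) :=
  exists sigma' : {linear P -> S j}, cancel sigma' tau.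
have ex_tau j : exists tau : {linear S j -> P},
    (exists tau', retraction j tau') -> retraction j tau.
  have [[tau' tau'P]|no] := pselect (exists tau', retraction j tau').
    by exists tau'.
  by exists \0.
pose tau j := projT1 (cid (ex_tau j)).
have [sigma' sigma'K] : retraction i (tau i).
  rewrite /tau; case: (cid _) => t /= ; apply.
  pose tauL := GRing.isLinear.Build R _ _ *:%R tau0 (can2_linear sigmaK tau0K).
  by exists (HB.pack tau0 tauL : {linear S i -> P}), sigma.
have [iota iotaE] := prod_map (fun j => char_map (tau j)).
exists iota, (char_map sigma' \o prod_proj _ i) => phi.
by apply: char_moduleP => p /=; rewrite iotaE /= sigma'K.
Qed.

Theorem proposition4 (R : pzRingType) (I : Type) (S : I -> lmodType R)
    (hS : complete_fp_representatives S) :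
  pi_indigent (prod_module (fun i : I => char_module (S i))).
Proof.
split=> [|N]; first exact: prod_char_module_pure_injective.
have [_ fpS _] := hS.
split=> [subN B C f g exfg|apN K i inji h]; last first.
  have [h' h'E] := prod_char_module_pure_injective
    (apN _ _ _ _ (coker_short_exact inji)) h.
  by exists h'.
have [injf _ _] := exfg.
split=> // L; have [kerg surg] := tensor_right_exact L exfg.
split=> //; apply: tensor_map_injective_fp => P /fpS[i isoP].
apply/char_module_injective_along => h.
have [iota [rho iotaK]] := char_module_summand_prod isoP.
have [k kE] := subN B f injf (iota \o h).
by exists (rho \o k) => n; rewrite /= kE /= iotaK.
Qed.
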